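(* Let $d\ge 2$ and let $G=(V,E)$ be a finite $d$-dimensional graph (without boundary). Then $$\sum_{p\in V} K(p)=\chi(G),$$ where $K(p)$ is the Euler curvature form of $G$ at the vertex $p$ and $\chi(G)$ is the Euler characteristic of $G$.
   Context: All graphs are finite, undirected, without self-loops and without multiple edges. Simplices and Euler characteristic: for a graph $G$, $v_k$ denotes the number of complete subgraphs $K_{k+1}$ of $G$ on $k+1$ vertices ($k$-dimensional simplices). The Euler characteristic of a $d$-dimensional graph is $\chi(G)=v_0-v_1+v_2-\cdots+(-1)^d v_d$. Unit sphere: for a vertex $p$, $S(p)=S_1(p)$ is the subgraph induced on the set of neighbors $\{q\in V:(p,q)\in E\}$, and $V_k=V_k(p)$ denotes the number of $k$-dimensional simplices of $S(p)$. $d$-dimensional graph (without boundary), defined inductively: a graph without any edges is $0$-dimensional. For $d\ge 1$, a graph $G$ is $d$-dimensional if (i) for every vertex $p$, the unit sphere $S(p)$ is a $(d-1)$-dimensional graph (in this same inductive sense) of Euler characteristic $1+(-1)^{d-1}$, and $S(p)$ is connected when $d\ge 2$; and (ii) $(d+1)v_d=2v_{d-1}$ holds in $G$. Euler curvature form: put $a_n=(-1)^n\left(\frac12-\frac1{n+2}\right)$ and $e_d=\frac{1+(-1)^d}{2}$. For a $d$-dimensional graph, $K(p)=e_d+V_1(p)\,a_1$ if $d=2$, and for $d>2$ $$K(p)=e_d+V_1(p)a_1+V_2(p)a_2+\cdots+V_{d-3}(p)a_{d-3}+V_{d-2}(p)\left(a_{d-2}+\frac{2a_{d-1}}{d}\right)$$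 (for $d=3$ this is $K(p)=e_3+V_1(p)(a_1+\frac{2a_2}{3})$). *)

(* Defs.v *)
From HB Require Import structures.
From mathcomp Require Import all_boot all_order all_algebra.
Set Implicit Arguments.
Unset Strict Implicit.
Unset Printing Implicit Defensive.
Import Order.TTheory GRing.Theory Num.Theory.
Local Open Scope ring_scope.

Record sgraph : Type := SGraph {
  vertex :> finType;
  edge : rel vertex;
  edge_sym : symmetric edge;
  edge_irrefl : irreflexive edge }.

Section Induced.
Variables (G : sgraph) (S : {set G}).

Definition induced_edge : rel {x : G | x \in S} :=
  fun u v => edge (val u) (val v).

Lemma induced_edge_sym : symmetric induced_edge.
Proof. by move=> u v; rewrite /induced_edge edge_sym. Qed.

Lemma induced_edge_irrefl : irreflexive induced_edge.
Proof. by move=> u; rewrite /induced_edge edge_irrefl. Qed.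

Definition induced : sgraph := SGraph induced_edge_sym induced_edge_irrefl.

End Induced.

Definition unit_sphere (G : sgraph) (p : G) : sgraph :=
  induced [set q : G | edge p q].

Definition clique (G : sgraph) (K : {set G}) : bool :=
  [forall x in K, forall y in K, (x != y) ==> edge x y].

Definition num_simplices (G : sgraph) (k : nat) : nat :=
  #|[set K : {set G} | (#|K| == k.+1) && clique K]|.

(* The alternating sum stops at [k = d]; it is meant for [d]-dimensional [G]. *)
Definition euler_char (d : nat) (G : sgraph) : int :=
  \sum_(k < d.+1) (-1) ^+ k * (num_simplices G k)%:Z.

(* Exactly one component: the empty graph is not connected. *)
Definition connected (G : sgraph) : Prop :=
  n_comp (@edge G) [pred x : G | true] = 1%N.

Fixpoint is_dim (d : nat) (G : sgraph) {struct d} : Prop :=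
  match d with
  | 0 => forall x y : G, ~~ edge x y
  | d'.+1 =>
      (forall p : G,
         [/\ is_dim d' (unit_sphere p),
             euler_char d' (unit_sphere p) = 1 + (-1) ^+ d'
           & (2 <= d'.+1)%N -> connected (unit_sphere p)])
      /\ (d'.+2 * num_simplices G d'.+1 = 2 * num_simplices G d')%N
  end.

Definition curv_coef (n : nat) : rat :=
  (-1) ^+ n * (1 / 2%:R - 1 / (n + 2)%N%:R).

Definition curv_const (d : nat) : rat := (1 + (-1) ^+ d) / 2%:R.

(* Meaningful for [2 <= d] only. *)
Definition curvature (d : nat) (G : sgraph) (p : G) : rat :=
  let V k : rat := (num_simplices (unit_sphere p) k)%:R in
  if d == 2%N then curv_const d + V 1%N * curv_coef 1%N
  else curv_const d
       + \sum_(1 <= k < d - 2) V k * curv_coef k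
       + V (d - 2)%N
         * (curv_coef (d - 2)%N + 2%:R * curv_coef (d - 1)%N / d%:R).

(* Main.v *)
Require Import Defs.
From mathcomp Require Import all_boot all_order all_algebra.
From mathcomp Require Import ring.
Import Order.TTheory GRing.Theory Num.Theory.
Local Open Scope ring_scope.

(** The curvature redistributes Euler characteristic from simplices to vertices.
    A [k]-simplex of the unit sphere of [p], joined with [p], is a
    [k+1]-simplex of the graph through [p], and a [k+1]-simplex has [k+2]
    vertices; hence the sum over [p] of [V_k(p)] is [(k+2) v_(k+1)]
    ([sum_unit_sphere_simplices]). Accordingly
    [V_k(p) a_k = (-1)^k V_k(p) / 2 + (-1)^(k+1) V_k(p) / (k+2)] is a sum of
    two terms ([curv_coef_mul]). The second, summed over [p], is exactly the
    term [(-1)^(k+1) v_(k+1)] of the Euler characteristic of the graph. The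
    first, summed over [k] at a fixed vertex, is half the Euler characteristic
    of the unit sphere, [(1 - (-1)^d) / 2]; the constant
    [e_d = (1 + (-1)^d) / 2] completes it to [1], and these units add up to the
    remaining term [v_0].

    This computation uses the uniform formula
    [K(p) = e_d + sum_(k < d) V_k(p) a_k]. It agrees with the definition of the
    curvature ([curvature_uniform]) because [a_0 = 0] and because the sphere,
    being [d-1]-dimensional, satisfies [d V_(d-1) = 2 V_(d-2)]. *)

Lemma cliqueP (G : sgraph) (K : {set G}) :
  reflect {in K &, forall x y, x != y -> edge x y} (clique K).
Proof.
apply: (iffP forall_inP) => [cK x y xK yK | cK x xK].
  by move/forall_inP: (cK x xK) => /(_ y yK) /implyP.
by apply/forall_inP => y yK; apply/implyP; apply: cK.
Qed.

Lemma num_simplices_induced (G : sgraph) (S : {set G}) (k : nat) :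
  num_simplices (induced S) k =
  #|[set K : {set G} | [&& K \subset S, #|K| == k.+1 & clique K]]|.
Proof.
rewrite /num_simplices.
pose f (K : {set induced S}) : {set G} := val @: K.
have f_inj : injective f by apply: imset_inj; apply: val_inj.
rewrite -(card_imset _ f_inj); apply: eq_card => K.
apply/imsetP/idP => [[L] | ].
  rewrite !inE => /andP[/eqP cardL /cliqueP cL] ->; apply/and3P; split.
  - by apply/subsetP => _ /imsetP[x _ ->]; apply: (valP x).
  - by rewrite card_imset ?cardL //; apply: val_inj.
  apply/cliqueP => _ _ /imsetP[x xL ->] /imsetP[y yL ->] nxy.
  by apply: (cL x y) => //; apply: contraNneq nxy => ->.
rewrite inE => /and3P[/subsetP KS /eqP cardK /cliqueP cK].
pose L : {set induced S} := [set x | val x \in K].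
have fL : K = f L.
  apply/setP => x; apply/idP/imsetP => [xK | [y]].
    by exists (Sub x (KS x xK)); rewrite ?inE SubK.
  by rewrite inE => yK ->.
exists L => //; rewrite inE; apply/andP; split.
  by rewrite -cardK fL card_imset //; apply: val_inj.
apply/cliqueP => x y; rewrite !inE => xK yK nxy.
by apply: cK => //; rewrite (inj_eq val_inj).
Qed.

(** Joining with [p] is a bijection, inverted by removing [p]. *)
Lemma num_simplices_unit_sphere (G : sgraph) (p : G) (k : nat) :
  num_simplices (unit_sphere p) k =
  #|[set K : {set G} | [&& #|K| == k.+2, clique K & p \in K]]|.
Proof.
rewrite /unit_sphere num_simplices_induced; set S := [set q | _].
have pS (K : {set G}) : K \subset S -> p \notin K.
  by move=> /subsetP KS; apply/negP => /KS; rewrite inE edge_irrefl.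
rewrite -(card_in_imset (f := fun K => p |: K)); last first.
  move=> K L; rewrite !inE => /and3P[/pS pK _ _] /and3P[/pS pL _ _] eqKL.
  by rewrite -(setU1K pK) eqKL setU1K.
apply: eq_card => K; apply/imsetP/idP => [[L] | ].
  rewrite !inE => /and3P[LS /eqP cardL /cliqueP cL] ->.
  rewrite cardsU1 pS // cardL setU11 eqxx andbT /=.
  have pL x : x \in L -> edge p x by move/(subsetP LS); rewrite inE.
  apply/cliqueP => x y /setU1P[->|xL] /setU1P[->|yL].
  - by rewrite eqxx.
  - by move=> _; apply: pL.
  - by move=> _; rewrite edge_sym; apply: pL.
  exact: cL.
rewrite inE => /and3P[/eqP cardK /cliqueP cK pK].
exists (K :\ p); last by rewrite setD1K.
rewrite inE; apply/and3P; split.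
- by apply/subsetP => x /setD1P[nxp xK]; rewrite inE; apply: cK; rewrite // eq_sym.
- by move: cardK; rewrite (cardsD1 p) pK add1n => -[->].
by apply/cliqueP => x y /setD1P[_ xK] /setD1P[_ yK]; apply: cK.
Qed.

(** Both sides count the pairs of a [k+1]-simplex and one of its vertices. *)
Lemma sum_unit_sphere_simplices (G : sgraph) (k : nat) :
  (\sum_(p : G) num_simplices (unit_sphere p) k
   = k.+2 * num_simplices G k.+1)%N.
Proof.
pose C := [set K : {set G} | (#|K| == k.+2) && clique K].
transitivity (\sum_(p : G) \sum_(K in C) (p \in K))%N.
  apply: eq_bigr => p _; rewrite num_simplices_unit_sphere -sum1_card.
  rewrite -big_mkcondr /=; apply: eq_bigl => K.
  by rewrite !inE andbA.
rewrite exchange_big /= mulnC -sum_nat_const; apply: eq_bigr => K.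
rewrite inE => /andP[/eqP <- _].
by rewrite -sum1_card [RHS]big_mkcond.
Qed.

Lemma num_simplices0 (G : sgraph) : num_simplices G 0 = #|G|.
Proof.
rewrite -cardsT -(card_imset _ (@set1_inj G)); apply: eq_card => K.
rewrite inE; apply/andP/imsetP => [[/cards1P[x ->] _] | [x _ ->]].
  by exists x.
rewrite cards1; split=> //; apply/cliqueP => y z.
by rewrite !inE => /eqP-> /eqP->; rewrite eqxx.
Qed.

Lemma curv_coef0 : curv_coef 0 = 0.
Proof. by rewrite /curv_coef subrr mulr0. Qed.

(** The last term of the sum is the one that the relation
    [d V_(d-1) = 2 V_(d-2)] eliminates from the definition when [d > 2]. *)
Lemma curvature_uniform (d : nat) (G : sgraph) (p : G) :
  (2 <= d)%N -> is_dim d.-1 (unit_sphere p) ->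
  curvature d p = curv_const d
    + \sum_(k < d) (num_simplices (unit_sphere p) k)%:R * curv_coef k.
Proof.
case: d => [|[|[|n]]] // _ /= dimS; rewrite /curvature /=.
  by rewrite !big_ord_recl big_ord0 /= curv_coef0 mulr0 add0r addr0.
have [_ regS] := dimS.
have -> : (n.+3 - 2 = n.+1)%N by rewrite subSS subSS subn0.
have -> : (n.+3 - 1 = n.+2)%N by rewrite subSS subn0.
rewrite -(big_mkord xpredT
            (fun k => (num_simplices (unit_sphere p) k)%:R * curv_coef k)).
rewrite [in RHS]big_nat_recr //= [in RHS]big_nat_recr //=.
rewrite [in RHS]big_nat_recl //= curv_coef0 mulr0 add0r big_add1 /= -!addrA; congr (_ + (_ + _)); rewrite mulrDr; congr (_ + _).
have {regS} := congr1 (fun m => m%:R : rat) regS; rewrite !natrM => regS.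
have n3 : (n.+3)%:R != 0 :> rat by rewrite pnatr_eq0.
apply: (mulfI n3); rewrite [RHS]mulrA regS.
by move: (n.+3%:R) n3 => x x_neq0; field.
Qed.

Lemma curv_coef_mul (V : rat) (k : nat) :
  V * curv_coef k = (-1) ^+ k * V / 2%:R + (-1) ^+ k.+1 * (V / k.+2%:R).
Proof. by rewrite /curv_coef addn2 exprS; ring. Qed.

Theorem theorem1 (d : nat) (G : sgraph) (hd : (2 <= d)%N)
    (hG : is_dim d G) :
  \sum_(p : G) curvature d p = (euler_char d G)%:~R.
Proof.
have eulerE e (H : sgraph) : (euler_char e H)%:~R =
    \sum_(k < e.+1) (-1) ^+ k * (num_simplices H k)%:R :> rat.
  rewrite /euler_char rmorph_sum /=; apply: eq_bigr => k _.
  by rewrite rmorphM rmorphXn rmorphN1.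
case: d hd hG => // d hd [sphereG _].
have curvE (p : G) : curvature d.+1 p = 1 + \sum_(k < d.+1)
    (-1) ^+ k.+1 * ((num_simplices (unit_sphere p) k)%:R / k.+2%:R).
  have [dimS chiS _] := sphereG p; rewrite curvature_uniform //.
  under eq_bigr => k _ do rewrite curv_coef_mul.
  rewrite big_split /= -mulr_suml -eulerE chiS addrA; congr (_ + _).
  by rewrite rmorphD rmorphXn rmorphN1 /curv_const exprS; field.
under eq_bigr => p _ do rewrite curvE.
rewrite big_split /= eulerE big_ord_recl num_simplices0 expr0 mul1r.
rewrite sumr_const; congr (_ + _).
rewrite exchange_big /=; apply: eq_bigr => k _.
rewrite -mulr_sumr -mulr_suml -natr_sum sum_unit_sphere_simplices natrM.
by rewrite mulrAC divff ?mul1r // pnatr_eq0.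
Qed.
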